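(* Let $\mathbb{F}$ be a field and let $\ominus$ be a uniform Kronecker difference over $\mathbb{F}$. Then there exist a sequence of matrices $\upsilon_n\in\mathbb{F}_n$, $n\in\mathbb{N}$, with $\operatorname{tr}(\upsilon_n)=1$, and matrices $\gamma_{m,n}\in\mathbb{F}_m\otimes\mathbb{F}_n\otimes\mathbb{F}_m=\mathbb{F}_{m^2n}$, $m,n\in\mathbb{N}$, with $\operatorname{tr}_1(\gamma_{m,n})=0$ and $\operatorname{tr}_2(\gamma_{m,n})=0$, such that $$A\ominus B=\operatorname{tr}_{12}\bigl(\alpha_{m,n}^T(A\otimes I_m-I_m\otimes B\otimes I_m)\bigr),\qquad \alpha_{m,n}:=\sum_{i,j=1}^m E_{ij}\otimes\upsilon_n\otimes E_{ji}+\gamma_{m,n},$$ for all $A\in\mathbb{F}_m\otimes\mathbb{F}_n$, $B\in\mathbb{F}_n$ and $m,n\in\mathbb{N}$.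
   Context: $\mathbb{F}_m$ is the space of $m\times m$ matrices over $\mathbb{F}$, $\mathbb{N}$ is the set of positive integers, $\otimes$ is the Kronecker product, and $\mathbb{F}_m\otimes\mathbb{F}_n$ is identified with $\mathbb{F}_{mn}$. $E_{ij}$ is the matrix unit with a $1$ in position $(i,j)$ and zeros elsewhere (here of size $m\times m$), and $I_m$ is the identity matrix. The Kronecker sum of $A\in\mathbb{F}_m$ and $B\in\mathbb{F}_n$ is $A\oplus B=A\otimes I_n+I_m\otimes B$. A Kronecker difference is a family of operations $\ominus:\mathbb{F}_{mn}\times\mathbb{F}_n\to\mathbb{F}_m$, indexed by $m,n\in\mathbb{N}$, such that $(A\oplus B)\ominus B=A$ for all $A\in\mathbb{F}_m$, $B\in\mathbb{F}_n$, $m,n\in\mathbb{N}$. It is uniform if $(A\oplus C)\ominus B=A\oplus(C\ominus B)$ for all $A\in\mathbb{F}_m$, $B\in\mathbb{F}_n$, $C\in\mathbb{F}_p\otimes\mathbb{F}_n$ and $m,n,p\in\mathbb{N}$, and moreover $(A+B)\ominus(C+D)=(A\ominus C)+(B\ominus D)$ and $(kA)\ominus(kC)=k(A\ominus C)$ for all matrices $A,B,C,D$ and scalars $k\in\mathbb{F}$ whenever the operations are defined. On $\mathbb{F}_m\otimes\mathbb{F}_n\otimes\mathbb{F}_m$ the following maps are defined by linear extension: $\operatorname{tr}_1(A\otimes B\otimes C)=\operatorname{tr}(A)\,B\otimes C$, $\operatorname{tr}_2(A\otimes B\otimes C)=\operatorname{tr}(B)\,A\otimes C$, $\operatorname{tr}_{12}(A\otimes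 B\otimes C)=\operatorname{tr}(A)\operatorname{tr}(B)\,C$. *)

(* Defs.v *)
From HB Require Import structures.
From mathcomp Require Export all_boot all_order all_algebra.
From mathcomp.real_closed Require Export mxtens.
From mathcomp Require Import ring.

Set Implicit Arguments.
Unset Strict Implicit.
Unset Printing Implicit Defensive.

Import GRing.Theory.
Local Open Scope ring_scope.

(* F_m (x) F_n (x) F_m is encoded as 'M_(m * n * m), that is, a triple Kronecker
   product is always bracketed to the left: A *t B *t C = (A *t B) *t C. *)

Definition kron_sum (F : fieldType) (m n : nat) (A : 'M[F]_m) (B : 'M[F]_n) :
    'M[F]_(m * n) :=
  A *t (1%:M : 'M_n) + (1%:M : 'M_m) *t B.

(* The families are indexed by all naturals, but every condition below
   constrains the operations for positive sizes only. *)
Definition mx_operations (F : fieldType) : Type :=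
  forall m n : nat, 'M[F]_(m * n) -> 'M[F]_n -> 'M[F]_m.

Definition kronecker_difference (F : fieldType) (ominus : mx_operations F) :
    Prop :=
  forall (m n : nat) (A : 'M[F]_m) (B : 'M[F]_n), (0 < m)%N -> (0 < n)%N ->
    ominus m n (kron_sum A B) B = A.

(* castmx implements the identification of F_m (x) (F_p (x) F_n) with
   (F_m (x) F_p) (x) F_n; it leaves the entries in place. *)
Record uniform_kronecker_difference (F : fieldType) (ominus : mx_operations F) :
    Prop := UniformKroneckerDifference {
  ukd_difference : kronecker_difference ominus;
  ukd_uniform : forall (m n p : nat)
      (A : 'M[F]_m) (B : 'M[F]_n) (C : 'M[F]_(p * n)),
    (0 < m)%N -> (0 < n)%N -> (0 < p)%N ->
    ominus (m * p)%N n (castmx (mulnA m p n, mulnA m p n) (kron_sum A C)) B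
      = kron_sum A (ominus p n C B);
  ukd_add : forall (m n : nat) (A B : 'M[F]_(m * n)) (C D : 'M[F]_n),
    (0 < m)%N -> (0 < n)%N ->
    ominus m n (A + B) (C + D) = ominus m n A C + ominus m n B D;
  ukd_scale : forall (m n : nat) (k : F) (A : 'M[F]_(m * n)) (C : 'M[F]_n),
    (0 < m)%N -> (0 < n)%N ->
    ominus m n (k *: A) (k *: C) = k *: ominus m n A C
}.

(* The linear extension to F_m (x) F_n (x) F_p of a map given on elementary
   tensors: X is expanded on the products of matrix units. *)
Definition tens3_ext (F : fieldType) (V : lmodType F) (m n p : nat)
    (f : 'M[F]_m -> 'M[F]_n -> 'M[F]_p -> V) (X : 'M[F]_(m * n * p)) : V :=
  \sum_(i < m) \sum_(i' < m) \sum_(j < n) \sum_(j' < n)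
  \sum_(k < p) \sum_(k' < p)
    X (mxtens_index (mxtens_index (i, j), k))
      (mxtens_index (mxtens_index (i', j'), k'))
    *: f (delta_mx i i') (delta_mx j j') (delta_mx k k').

Definition tr1 (F : fieldType) (m n : nat) : 'M[F]_(m * n * m) -> 'M[F]_(n * m) :=
  tens3_ext (fun A B C => \tr A *: (B *t C)).

Definition tr2 (F : fieldType) (m n : nat) : 'M[F]_(m * n * m) -> 'M[F]_(m * m) :=
  tens3_ext (fun A B C => \tr B *: (A *t C)).

Definition tr12 (F : fieldType) (m n : nat) : 'M[F]_(m * n * m) -> 'M[F]_m :=
  tens3_ext (fun A B C => (\tr A * \tr B) *: C).

Lemma tens3_ext_linear (F : fieldType) (V : lmodType F) (m n p : nat)
    (f : 'M[F]_m -> 'M[F]_n -> 'M[F]_p -> V) :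
  linear (tens3_ext f).
Proof.
move=> a X Y; rewrite /tens3_ext.
do 6![rewrite scaler_sumr -big_split /=; apply: eq_bigr => ? _].
by rewrite !mxE scalerDl scalerA.
Qed.

Lemma tens3_ext_tens (F : fieldType) (V : lmodType F) (m n p : nat)
    (f : 'M[F]_m -> 'M[F]_n -> 'M[F]_p -> V) A B C :
  (forall B C, linear (fun A => f A B C)) ->
  (forall A C, linear (fun B => f A B C)) ->
  (forall A B, linear (fun C => f A B C)) ->
  tens3_ext f (A *t B *t C) = f A B C.
Proof.
have lin q (g : 'M[F]_q -> V) : linear g ->
    forall X, g X = \sum_i \sum_j X i j *: g (delta_mx i j).
  move=> gl X; pose gL := GRing.isLinear.Build F 'M[F]_q V *:%R g gl.
  pose h : {linear 'M[F]_q -> V} := HB.pack g gL.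
  rewrite -[g]/(h : _ -> _) [in LHS](matrix_sum_delta X) linear_sum.
  apply: eq_bigr => i _; rewrite linear_sum; apply: eq_bigr => j _.
  by rewrite linearZ.
move=> lA lB lC; rewrite (lin _ _ (lA B C) A).
apply: eq_bigr => i _; apply: eq_bigr => i' _.
rewrite (lin _ _ (lB _ C) B) scaler_sumr; apply: eq_bigr => j _.
rewrite scaler_sumr; apply: eq_bigr => j' _.
rewrite (lin _ _ (lC _ _) C) !scaler_sumr; apply: eq_bigr => k _.
rewrite !scaler_sumr; apply: eq_bigr => k' _.
by rewrite !tensmxE !scalerA.
Qed.

Lemma tr1_tens (F : fieldType) (m n : nat) (A : 'M[F]_m) (B : 'M[F]_n)
    (C : 'M[F]_m) :
  tr1 (A *t B *t C) = \tr A *: (B *t C).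
Proof.
apply: tens3_ext_tens => {A B C} [B C|A C|A B] a X Y /=.
- by rewrite mxtraceD mxtraceZ scalerDl scalerA.
- by apply/matrixP => i j; rewrite !mxE; ring.
- by apply/matrixP => i j; rewrite !mxE; ring.
Qed.

Lemma tr2_tens (F : fieldType) (m n : nat) (A : 'M[F]_m) (B : 'M[F]_n)
    (C : 'M[F]_m) :
  tr2 (A *t B *t C) = \tr B *: (A *t C).
Proof.
apply: tens3_ext_tens => {A B C} [B C|A C|A B] a X Y /=.
- by apply/matrixP => i j; rewrite !mxE; ring.
- by rewrite mxtraceD mxtraceZ scalerDl scalerA.
- by apply/matrixP => i j; rewrite !mxE; ring.
Qed.

Lemma tr12_tens (F : fieldType) (m n : nat) (A : 'M[F]_m) (B : 'M[F]_n)
    (C : 'M[F]_m) :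
  tr12 (A *t B *t C) = (\tr A * \tr B) *: C.
Proof.
apply: tens3_ext_tens => {A B C} [B C|A C|A B] a X Y /=.
- by rewrite mxtraceD mxtraceZ mulrDl scalerDl scalerA mulrA.
- by rewrite mxtraceD mxtraceZ mulrDr scalerDl scalerA mulrCA.
- by rewrite scalerDr !scalerA mulrC.
Qed.

(* Main.v *)
(* By joint linearity, A (-) B = phi (A - 1 (x) B) where phi X := X (-) 0 is
   linear and phi (A (x) 1) = A.  Uniformity with p = 1 forces phi (1 (x) B) to
   be the scalar matrix of a linear form of B; upsilon represents that form, and
   its trace is the value 1 of the form at the identity.  Writing phi X as
   tr12 (alpha^T (X (x) 1)), the two identities for phi say exactly that tr2 and
   tr1 of alpha agree with those of the sum of the E_ij (x) upsilon (x) E_ji. *)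
From HB Require Import structures.
Require Import Defs.

Set Implicit Arguments.
Unset Strict Implicit.
Unset Printing Implicit Defensive.

Import GRing.Theory.
Local Open Scope ring_scope.

(** * Kronecker products, matrix units and the swap matrix *)

Lemma sum_mxtens_index (V : nmodType) (m n : nat) (f : 'I_(m * n) -> V) :
  \sum_r f r = \sum_(i < m) \sum_(j < n) f (mxtens_index (i, j)).
Proof.
rewrite pair_big (reindex (@mxtens_index m n)) /=.
  by apply: eq_bigr => -[].
exists (@mxtens_unindex m n) => k _.
  exact: mxtens_indexK.
exact: mxtens_unindexK.
Qed.

Lemma tensmx_scalar (R : pzRingType) (m n : nat) (a b : R) :
  (a%:M : 'M_m) *t (b%:M : 'M_n) = (a * b)%:M.
Proof.
apply/matrixP => r s.
case: (mxtens_indexP r) => i j; case: (mxtens_indexP s) => k l.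
rewrite tensmxE !mxE (can_eq (@mxtens_indexK m n)) xpair_eqE.
by rewrite mulrnAl mulrnAr -mulrnA mulnb andbC.
Qed.

Lemma tensmx_suml (R : pzRingType) (I : finType) (m n p q : nat)
    (A : I -> 'M[R]_(m, n)) (B : 'M[R]_(p, q)) :
  (\sum_i A i) *t B = \sum_i A i *t B.
Proof.
apply/matrixP => r s; rewrite summxE mxE summxE mulr_suml.
by apply: eq_bigr => i _; rewrite mxE.
Qed.

Lemma tensmx_sumr (R : pzRingType) (I : finType) (m n p q : nat)
    (A : 'M[R]_(m, n)) (B : I -> 'M[R]_(p, q)) :
  A *t (\sum_i B i) = \sum_i A *t B i.
Proof.
apply/matrixP => r s; rewrite summxE mxE summxE mulr_sumr.
by apply: eq_bigr => i _; rewrite mxE.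
Qed.

(** Both bracketings number a triple as [(i * p + j) * n + k]; this removes the cast from the
    uniformity axiom. *)
Lemma tensmxA_cast (R : comPzRingType) (m p n : nat)
    (A : 'M[R]_m) (B : 'M[R]_p) (C : 'M[R]_n) :
  castmx (mulnA m p n, mulnA m p n) (A *t (B *t C)) = A *t B *t C.
Proof.
apply/matrixP => r s; case: (mxtens_indexP r) => r' k.
case: (mxtens_indexP r') => i j; case: (mxtens_indexP s) => s' k'.
case: (mxtens_indexP s') => i' j'; rewrite !tensmxE castmxE.
have e x y z : cast_ord (esym (mulnA m p n))
    (mxtens_index (mxtens_index (x, y), z)) =
    mxtens_index (x, mxtens_index (y, z)).
  by apply: val_inj => /=; rewrite mulnDl -mulnA addnA.
by rewrite !e !tensmxE mulrA.
Qed.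

Lemma delta_mx_tens (R : pzRingType) (m n p q : nat)
    (i : 'I_m) (i' : 'I_n) (j : 'I_p) (j' : 'I_q) :
  (delta_mx i i' : 'M[R]_(m, n)) *t (delta_mx j j' : 'M[R]_(p, q)) =
  delta_mx (mxtens_index (i, j)) (mxtens_index (i', j')).
Proof.
apply/matrixP => r s.
case: (mxtens_indexP r) => a b; case: (mxtens_indexP s) => c d.
rewrite tensmxE !mxE !(can_eq (@mxtens_indexK _ _)) !xpair_eqE -natrM mulnb.
by rewrite andbACA.
Qed.

Lemma mxtrace_delta (R : pzSemiRingType) (n : nat) (i j : 'I_n) :
  \tr (delta_mx i j : 'M[R]_n) = (i == j)%:R.
Proof.
rewrite /mxtrace (big_only1 i) => [||k ki _]; rewrite ?mxE ?eqxx //.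
by rewrite (negPf ki).
Qed.

(** The sum is the matrix swapping the two tensor factors: its entry is 1 exactly when [i = k'] and
    [k = i']. The right side has the shape in which [tr2_kernel] meets it. *)
Lemma swapmxE (R : pzRingType) (m : nat) (i i' k k' : 'I_m) :
  (\sum_(a < m) \sum_(b < m)
     (delta_mx a b : 'M[R]_m) *t (delta_mx b a : 'M[R]_m))
    (mxtens_index (i, k)) (mxtens_index (i', k')) =
  (delta_mx i i' : 'M[R]_m) k' k.
Proof.
rewrite summxE (big_only1 i) => // [|a ne _]; last first.
  rewrite summxE big1 // => b _.
  by rewrite tensmxE !mxE eq_sym (negPf ne) mul0r.
rewrite summxE (big_only1 i') => // [|b ne _]; last first.
  by rewrite tensmxE !mxE [i' == b]eq_sym (negPf ne) andbF mul0r.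
by rewrite tensmxE !mxE !eqxx mul1r andbC.
Qed.

(** * Entries of the partial traces, and linear maps written through [tr12] *)

Section PartialTraces.

Variables (F : fieldType) (m n : nat).

HB.instance Definition _ := GRing.isLinear.Build F _ _ _ (@tr1 F m n)
  (tens3_ext_linear (fun A B C => \tr A *: (B *t C))).
HB.instance Definition _ := GRing.isLinear.Build F _ _ _ (@tr2 F m n)
  (tens3_ext_linear (fun A B C => \tr B *: (A *t C))).

(** The trace factor kills the terms with distinct indices in the first tensor factor; reading off
    one entry fixes the other four indices. *)
Lemma tr1E (X : 'M[F]_(m * n * m)) (j j' : 'I_n) (k k' : 'I_m) :
  tr1 X (mxtens_index (j, k)) (mxtens_index (j', k')) =
  \sum_i X (mxtens_index (mxtens_index (i, j), k))
           (mxtens_index (mxtens_index (i, j'), k')).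
Proof.
rewrite /tr1 /tens3_ext summxE; apply: eq_bigr => i _.
rewrite (big_only1 i) => // [|i' ne _]; last first.
  by do 4![rewrite big1 // => ? _];
     rewrite mxtrace_delta eq_sym (negPf ne) scale0r scaler0.
rewrite summxE (big_only1 j) => // [|? ne _]; last first.
  do 3![rewrite summxE big1 // => ? _].
  by rewrite !mxE !mxtens_indexK /= eq_sym (negPf ne) !(mul0r, mulr0).
rewrite summxE (big_only1 j') => // [|? ne _]; last first.
  do 2![rewrite summxE big1 // => ? _].
  by rewrite !mxE !mxtens_indexK /=
     [j' == _]eq_sym (negPf ne) andbF !(mul0r, mulr0).
rewrite summxE (big_only1 k) => // [|? ne _]; last first.
  rewrite summxE big1 // => ? _.
  by rewrite !mxE !mxtens_indexK /= [k == _]eq_sym (negPf ne) !(mul0r, mulr0).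
rewrite summxE (big_only1 k') => // [|? ne _]; last first.
  by rewrite !mxE !mxtens_indexK /=
     [k' == _]eq_sym (negPf ne) andbF !(mul0r, mulr0).
by rewrite mxtrace_delta !mxE !mxtens_indexK /= !eqxx !mulr1.
Qed.

Lemma tr2E (X : 'M[F]_(m * n * m)) (i i' k k' : 'I_m) :
  tr2 X (mxtens_index (i, k)) (mxtens_index (i', k')) =
  \sum_j X (mxtens_index (mxtens_index (i, j), k))
           (mxtens_index (mxtens_index (i', j), k')).
Proof.
rewrite /tr2 /tens3_ext summxE (big_only1 i) => // [|? ne _]; last first.
  do 5![rewrite summxE big1 // => ? _].
  by rewrite !mxE !mxtens_indexK /= eq_sym (negPf ne) !(mul0r, mulr0).
rewrite summxE (big_only1 i') => // [|? ne _]; last first.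
  do 4![rewrite summxE big1 // => ? _].
  by rewrite !mxE !mxtens_indexK /=
     [i' == _]eq_sym (negPf ne) andbF !(mul0r, mulr0).
rewrite summxE; apply: eq_bigr => j _.
rewrite (big_only1 j) => // [|? ne _]; last first.
  by do 2![rewrite big1 // => ? _];
     rewrite mxtrace_delta eq_sym (negPf ne) scale0r scaler0.
rewrite summxE (big_only1 k) => // [|? ne _]; last first.
  rewrite summxE big1 // => ? _.
  by rewrite !mxE !mxtens_indexK /= [k == _]eq_sym (negPf ne) !(mul0r, mulr0).
rewrite summxE (big_only1 k') => // [|? ne _]; last first.
  by rewrite !mxE !mxtens_indexK /=
     [k' == _]eq_sym (negPf ne) andbF !(mul0r, mulr0).
by rewrite mxtrace_delta !mxE !mxtens_indexK /= !eqxx !mulr1.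
Qed.

Lemma tr12E (X : 'M[F]_(m * n * m)) (k k' : 'I_m) :
  tr12 X k k' = \sum_r X (mxtens_index (r, k)) (mxtens_index (r, k')).
Proof.
rewrite sum_mxtens_index /tr12 /tens3_ext summxE; apply: eq_bigr => i _.
rewrite (big_only1 i) => // [|i' ne _]; last first.
  by do 4![rewrite big1 // => ? _];
     rewrite !mxtrace_delta eq_sym (negPf ne) mul0r scale0r scaler0.
rewrite summxE; apply: eq_bigr => j _.
rewrite (big_only1 j) => // [|? ne _]; last first.
  by do 2![rewrite big1 // => ? _];
     rewrite !mxtrace_delta [j == _]eq_sym (negPf ne) mulr0 scale0r scaler0.
rewrite summxE (big_only1 k) => // [|? ne _]; last first.
  rewrite summxE big1 // => ? _.
  by rewrite !mxE /= [k == _]eq_sym (negPf ne) !(mul0r, mulr0).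
rewrite summxE (big_only1 k') => // [|? ne _]; last first.
  by rewrite !mxE /= [k' == _]eq_sym (negPf ne) andbF !(mul0r, mulr0).
by rewrite !mxtrace_delta !mxE /= !eqxx !mulr1.
Qed.

(** Only the terms with [i = j] have a first factor of nonzero trace, and the matrices
    [delta_mx i i] add up to the identity. *)
Lemma tr1_swap (B : 'M[F]_n) :
  tr1 (\sum_(i < m) \sum_(j < m)
         (delta_mx i j : 'M_m) *t B *t (delta_mx j i : 'M_m)) =
  B *t (1%:M : 'M_m).
Proof.
rewrite mx1_sum_delta tensmx_sumr linear_sum; apply: eq_bigr => i _.
rewrite linear_sum (big_only1 i) => // [|j ne _].
  by rewrite /= tr1_tens mxtrace_delta eqxx scale1r.
by rewrite /= tr1_tens mxtrace_delta eq_sym (negPf ne) scale0r.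
Qed.

Lemma tr2_swap (B : 'M[F]_n) :
  tr2 (\sum_(i < m) \sum_(j < m)
         (delta_mx i j : 'M_m) *t B *t (delta_mx j i : 'M_m)) =
  \tr B *: \sum_(i < m) \sum_(j < m)
             (delta_mx i j : 'M_m) *t (delta_mx j i : 'M_m).
Proof.
rewrite scaler_sumr linear_sum; apply: eq_bigr => i _.
by rewrite scaler_sumr linear_sum; apply: eq_bigr => j _; rewrite /= tr2_tens.
Qed.

(* The only [alpha] that can satisfy
   [phi X = tr12 (alpha^T *m (X *t 1%:M))] for all [X]. *)
Definition tr12_kernel (phi : 'M[F]_(m * n) -> 'M[F]_m) : 'M[F]_(m * n * m) :=
  \matrix_(u, v) phi (delta_mx (mxtens_unindex u).1 (mxtens_unindex v).1)
                     (mxtens_unindex v).2 (mxtens_unindex u).2.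

Lemma tr12_kernelE (phi : 'M[F]_(m * n) -> 'M[F]_m) r s k k' :
  tr12_kernel phi (mxtens_index (r, k)) (mxtens_index (s, k')) =
  phi (delta_mx r s) k' k.
Proof. by rewrite mxE !mxtens_indexK. Qed.

Variable phi : {linear 'M[F]_(m * n) -> 'M[F]_m}.

(** After transposition, entry [(k, k')] of the left side is the sum over [s, r] of [X s r] times
    [phi (delta_mx s r) k k'], which is [phi X] expanded on matrix units. *)
Lemma tr12_kernelK (X : 'M[F]_(m * n)) :
  tr12 ((tr12_kernel phi)^T *m (X *t (1%:M : 'M_m))) = phi X.
Proof.
rewrite [in RHS](matrix_sum_delta X) linear_sum; apply/matrixP => k k'.
rewrite tr12E summxE.
under eq_bigr do rewrite mxE sum_mxtens_index.
rewrite exchange_big /=; apply: eq_bigr => r _.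
rewrite linear_sum summxE; apply: eq_bigr => s _.
(* The identity in the last tensor factor forces the third summation index to be [k']. *)
rewrite (big_only1 k') => // [|? ne _]; last first.
  by rewrite tensmxE [X in _ * (_ * X)]mxE (negPf ne) !mulr0.
by rewrite mxE tr12_kernelE tensmxE linearZ !mxE eqxx mulr1 mulrC.
Qed.

(** Tracing out a factor sums its diagonal matrix units to the identity inside [phi]. So [tr1]
    records [phi] on [1 (x) B], and likewise [tr2] records it on [A (x) 1]. *)
Lemma tr1_kernel (j j' : 'I_n) (k k' : 'I_m) :
  tr1 (tr12_kernel phi) (mxtens_index (j, k)) (mxtens_index (j', k')) =
  phi ((1%:M : 'M_m) *t delta_mx j j') k' k.
Proof.
rewrite tr1E; under eq_bigr do rewrite tr12_kernelE -delta_mx_tens.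
by rewrite -summxE -linear_sum mx1_sum_delta tensmx_suml.
Qed.

Lemma tr2_kernel (i i' k k' : 'I_m) :
  tr2 (tr12_kernel phi) (mxtens_index (i, k)) (mxtens_index (i', k')) =
  phi (delta_mx i i' *t (1%:M : 'M_n)) k' k.
Proof.
rewrite tr2E; under eq_bigr do rewrite tr12_kernelE -delta_mx_tens.
by rewrite -summxE -linear_sum mx1_sum_delta tensmx_sumr.
Qed.

End PartialTraces.

(** * Values of a uniform Kronecker difference with second argument 0 *)

Section UniformKroneckerDifference.

Variables (F : fieldType) (ominus : mx_operations F).
Hypothesis ukd : uniform_kronecker_difference ominus.

Lemma ukd_linear (m n : nat) : (0 < m)%N -> (0 < n)%N ->
  linear (fun X : 'M[F]_(m * n) => ominus X 0).
Proof.
move=> m0 n0 a X Y.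
by rewrite -(ukd_scale ukd) // scaler0 -(ukd_add ukd) // addr0.
Qed.

Lemma ukd_tens1 (m n : nat) (A : 'M[F]_m) : (0 < m)%N -> (0 < n)%N ->
  ominus (A *t (1%:M : 'M_n)) 0 = A.
Proof.
move=> m0 n0; rewrite -[RHS](ukd_difference ukd A (0 : 'M_n)) //.
by rewrite /kron_sum tensmx0 addr0.
Qed.

(** Since [1 (x) B] is the Kronecker sum of 0 and [B], its difference with [B] is 0, and joint
    additivity splits it off. *)
Lemma ukdE (m n : nat) (A : 'M[F]_(m * n)) (B : 'M[F]_n) :
  (0 < m)%N -> (0 < n)%N ->
  ominus A B = ominus (A - (1%:M : 'M_m) *t B) 0.
Proof.
move=> m0 n0; have := ukd_difference ukd (0 : 'M_m) B m0 n0.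
rewrite /kron_sum tens0mx add0r => E.
by rewrite -[RHS]addr0 -[X in _ + X]E -(ukd_add ukd) // subrK add0r.
Qed.

(** The factor [1%:M : 'M_1] puts [B] into size [1 * n]; the last two zeros select the only entry of
    a 1 by 1 result. *)
Definition upsilon_form (n : nat) (B : 'M[F]_n) : F :=
  ominus ((1%:M : 'M_1) *t B) 0 0 0.

Lemma ukd_1tens (m n : nat) (B : 'M[F]_n) : (0 < m)%N -> (0 < n)%N ->
  ominus ((1%:M : 'M_m) *t B) 0 = (upsilon_form B)%:M.
Proof.
move=> m0 n0.
(* With [A = 0] and [p = 1], the right side becomes the identity tensored with a 1 by 1 matrix,
   hence scalar. *)
have := ukd_uniform ukd (0 : 'M_m) (0 : 'M_n) ((1%:M : 'M_1) *t B) m0 n0 isT.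
rewrite /kron_sum !tens0mx !add0r tensmxA_cast tensmx_scalar mulr1.
rewrite [ominus _ 0 in RHS]mx11_scalar -/(upsilon_form B) tensmx_scalar mul1r.
by rewrite muln1.
Qed.

End UniformKroneckerDifference.

Theorem theorem7 (F : fieldType) (ominus : mx_operations F)
    (hominus : uniform_kronecker_difference ominus) :
  exists (upsilon : forall n : nat, 'M[F]_n)
         (gamma : forall m n : nat, 'M[F]_(m * n * m)),
    [/\ forall n : nat, (0 < n)%N -> \tr (upsilon n) = 1,
        forall m n : nat, (0 < m)%N -> (0 < n)%N ->
          tr1 (gamma m n) = 0 /\ tr2 (gamma m n) = 0
      & forall (m n : nat) (A : 'M[F]_(m * n)) (B : 'M[F]_n),
          (0 < m)%N -> (0 < n)%N ->
          let alpha : 'M[F]_(m * n * m) :=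
            \sum_(i < m) \sum_(j < m)
              (delta_mx i j : 'M_m) *t upsilon n *t (delta_mx j i : 'M_m)
            + gamma m n in
          ominus m n A B =
            tr12 (alpha^T *m (A *t (1%:M : 'M_m)
                              - (1%:M : 'M_m) *t B *t (1%:M : 'M_m)))].
Proof.
(* For [n > 0] the form is then [B] mapped to the trace of [upsilon^T B]. *)
exists (fun n => \matrix_(j, j') upsilon_form ominus (delta_mx j j')).
pose ups n : 'M[F]_n := \matrix_(j, j') upsilon_form ominus (delta_mx j j').
pose S m n : 'M[F]_(m * n * m) := \sum_(i < m) \sum_(j < m)
  (delta_mx i j : 'M_m) *t ups n *t (delta_mx j i : 'M_m).
pose K m n := tr12_kernel (fun X : 'M[F]_(m * n) => ominus m n X 0).
(* This choice makes [alpha] equal to the kernel [K], so the content lies in the two trace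
   conditions. *)
exists (fun m n => K m n - S m n).
(* [K] is defined for all sizes from a bare function; linearity is available for positive sizes. *)
have kernel m n : (0 < m)%N -> (0 < n)%N ->
    exists2 phi : {linear 'M[F]_(m * n) -> 'M[F]_m},
      forall X, ominus m n X 0 = phi X & K m n = tr12_kernel phi.
  move=> m0 n0.
  pose L := GRing.isLinear.Build F _ _ _ _ (ukd_linear hominus m0 n0).
  pose f X := ominus m n X 0.
  pose phi : {linear 'M[F]_(m * n) -> 'M[F]_m} := HB.pack f L.
  by exists phi.
have tr_ups n : (0 < n)%N -> \tr (ups n) = 1.
  move=> n0; have [phi phiE _] := kernel 1%N n isT n0.
  have := ukd_tens1 hominus (1%:M : 'M_1) isT n0.
  (* Expanding the identity of size [n] turns the value 1 of the form there into the sum of the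
     diagonal entries of [ups n]. *)
  rewrite phiE [X in _ *t X]mx1_sum_delta tensmx_sumr linear_sum.
  move/matrixP/(_ 0 0); rewrite summxE mxE /= => sum1.
  rewrite -[RHS]sum1.
  by apply: eq_bigr => j _; rewrite mxE /upsilon_form phiE.
split=> //.
- move=> m n m0 n0; have [phi phiE KE] := kernel m n m0 n0.
  (* It remains to match [tr1] of the kernel with [ups n *t 1%:M], and [tr2] with the swap matrix,
     whose coefficient is the trace 1. *)
  rewrite !linearB /= KE tr1_swap tr2_swap tr_ups // scale1r.
  split; apply/eqP; rewrite subr_eq0; apply/eqP/matrixP => u v;
    case: (mxtens_indexP u) => j k; case: (mxtens_indexP v) => j' k'.
    rewrite tr1_kernel -phiE (ukd_1tens hominus) // tensmxE !mxE.
    by rewrite mulr_natr eq_sym.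
  by rewrite tr2_kernel -phiE (ukd_tens1 hominus) // swapmxE.
- move=> m n A B m0 n0 /=; have [phi phiE KE] := kernel m n m0 n0.
  (* Here [S + (K - S)] collapses to [K]. *)
  rewrite (ukdE hominus) // [X in X^T]addrC subrK KE.
  have -> : A *t (1%:M : 'M_m) - (1%:M : 'M_m) *t B *t (1%:M : 'M_m) =
            (A - (1%:M : 'M_m) *t B) *t (1%:M : 'M_m).
    by apply/matrixP => u v; rewrite !mxE mulrBl.
  by rewrite tr12_kernelK phiE.
Qed.
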